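(* In $\mathsf{ZFC}$, there exists a zero-dimensional space that is not $\sigma$-homogeneous.
   Context: By ''space'' we always mean a separable metrizable topological space. A space is zero-dimensional if it is non-empty and has a base consisting of clopen sets. A space $X$ is homogeneous if for every $x,y\in X$ there exists a homeomorphism $h:X\longrightarrow X$ such that $h(x)=y$. A space $X$ is $\sigma$-homogeneous if there exist homogeneous subspaces $X_n$ of $X$ for $n\in\omega$ such that $X=\bigcup_{n\in\omega}X_n$. *)

(* Defs.v *)
From HB Require Import structures.
From mathcomp Require Import all_boot all_order all_algebra.
From mathcomp Require Import all_classical all_reals all_analysis.

Set Implicit Arguments.
Unset Strict Implicit.
Unset Printing Implicit Defensive.

Local Open Scope classical_set_scope.

Definition homeomorphism (X Y : topologicalType) (h : X -> Y) : Prop :=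
  continuous h /\
  exists2 g : Y -> X, continuous g & cancel h g /\ cancel g h.

Definition separable (X : topologicalType) : Prop :=
  exists2 D : set X, countable D & dense D.

Definition metrizable (R : realType) (X : topologicalType) : Prop :=
  exists (M : metricType R) (h : X -> M), homeomorphism h.

(* The convention that "space" means a separable metrizable topological
   space. *)
Definition is_space (R : realType) (X : topologicalType) : Prop :=
  separable X /\ metrizable R X.

(* Not to be confused with [zero_dimensional] of MathComp-Analysis, which only
   asks that distinct points be separated by a clopen set and allows the empty
   space. *)
Definition zero_dimensional_space (X : topologicalType) : Prop :=
  [set: X] !=set0 /\ exists2 B : set (set X), basis B & B `<=` clopen.

Definition homogeneous (X : topologicalType) : Prop :=
  forall x y : X, exists2 h : X -> X, homeomorphism h & h x = y.

(* [set_type A] carries the initial topology of the inclusion of [A] in [X],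
   i.e. the subspace topology (whereas in [subspace A] the carrier is the whole
   of [X], with the points outside [A] isolated). *)
Definition sigma_homogeneous (X : topologicalType) : Prop :=
  exists A : nat -> set X,
    (forall n, homogeneous (set_type (A n))) /\ \bigcup_n A n = [set: X].

(* Main.v *)
Require Import Defs.
From HB Require Import structures.
From mathcomp Require Import all_boot all_order all_algebra.
From mathcomp Require Import all_classical all_reals all_analysis.

(** Writing [2^omega] for the Cantor set, the example is a subspace [S] of
    [2^omega] of the size of the continuum, on which partial homeomorphisms are
    nearly trivial: every homeomorphism between two subspaces of [S] moves fewer
    than continuum many points.

    Such an [S] suffices.  The cofinality of the continuum is uncountable
    ([small_bigcup]), so if [S] is the union of countably many homogeneous
    subspaces, one of them, [A], has the size of the continuum.  For the same
    reason some point [a] of [A] has only neighborhoods of that size in [A],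
    since the topology has a countable base.  A homeomorphism of [A] that sends
    [a] to a point [b <> a] moves all points of a neighborhood of [a], hence
    continuum many ([homogeneous_moves]), a contradiction.

    To construct [S], note that a continuous map between subspaces of [2^omega]
    is determined by the pairs [(s, t)] of basic clopen sets such that it sends
    the points in [s] into [t].  Hence all these maps are restrictions of
    functions [F c], where the code [c] is itself a point of [2^omega]
    ([continuous_coded], [decoding_exists]).  Well-order the codes in the least
    possible type, and choose points [x t] by recursion so that [x t] avoids the
    earlier points and all [F c (x v)] with [c] and [v] earlier than [t].  This is
    possible because fewer than continuum many values are forbidden, which
    rests on Hessenberg's theorem [card_square_below].  If a homeomorphism moves
    [x v] to [x t] with [v] earlier than [t], then its code is not earlier than
    [t]; if [t] is earlier than [v], the code of the inverse is not earlier than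
    [v].  In both cases [v] is bounded by one of the two codes ([rigid_set]). *)

Set Implicit Arguments.
Unset Strict Implicit.
Unset Printing Implicit Defensive.

Local Open Scope classical_set_scope.
Local Open Scope card_scope.

(** * Well-orderings and recursion *)

(** A strict well-ordering: well-founded and trichotomous, which together
    entail transitivity. *)
Definition well_ordering (T : Type) (lt : T -> T -> Prop) :=
  well_founded lt /\ forall x y, lt x y \/ x = y \/ lt y x.

(** The initial segment of the elements below [t]. *)
Definition below (T : Type) (lt : T -> T -> Prop) (t : T) : set T :=
  [set s | lt s t].

Lemma wf_asym (T : Type) (lt : T -> T -> Prop) x y :
  well_founded lt -> lt x y -> ~ lt y x.
Proof.
move=> wf; elim/(well_founded_ind wf): x y => x IH y xy yx.
exact: (IH y yx x yx xy).
Qed.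

Lemma wo_trans (T : Type) (lt : T -> T -> Prop) :
  well_ordering lt -> forall x y z, lt x y -> lt y z -> lt x z.
Proof.
move=> [wf tri] x; elim/(well_founded_ind wf): x => x IH y z xy yz.
case: (tri x z) => [//|[xz|zx]]; first by subst z; case: (wf_asym wf xy).
by have := IH z zx x y zx xy => /(wf_asym wf); case.
Qed.

Lemma wf_min (T : Type) (lt : T -> T -> Prop) (P : T -> Prop) :
  well_founded lt -> (exists t, P t) ->
  exists2 t, P t & forall s, lt s t -> ~ P s.
Proof.
move=> wf [t]; elim/(well_founded_ind wf): t => t IH Pt.
have [[s [st Ps]]|no] := pselect (exists s, lt s t /\ P s); first exact: IH Ps.
by exists t => // s st Ps; apply: no; exists s.
Qed.

Lemma well_ordering_exists (T : eqType) :
  exists lt : T -> T -> Prop, well_ordering lt.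
Proof.
have [R Rwo] := wochoice.well_ordering_principle T.
have anti x y : R x y -> R y x -> x = y.
  move=> xy yx.
  have RR : wochoice.wo_chain R predT by move=> A _; exact: Rwo.
  by apply: (wochoice.wo_chain_antisymmetric RR) => //; rewrite xy yx.
have tot x y : R x y || R y x.
  have RR : wochoice.wo_chain R predT by move=> A _; exact: Rwo.
  exact: (wochoice.wo_chainW RR).
exists (fun x y => ~~ R y x); split=> [x|x y].
  apply: contrapT => nax.
  have [|z [[/asboolP nAz minz] _]] := Rwo
      [pred x | `[< ~ Acc (fun x y => ~~ R y x) x >]].
    by exists x; apply/asboolP.
  apply: nAz; constructor => y /negP Rzy; apply: contrapT => nAy.
  by apply: Rzy; apply: minz; apply/asboolP.
have [xy|xy] := boolP (R x y); last by right; right.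
have [yx|yx] := boolP (R y x); last by left.
by right; left; exact: anti.
Qed.

(** Well-founded recursion: [g p] may depend on the restriction of [g] to the
    predecessors of [p], here extended by a default value. *)
Lemma wf_recursion (T : Type) (U : pointedType) (lt : T -> T -> Prop)
    (Phi : T -> (T -> U) -> U) :
  well_founded lt ->
  exists g : T -> U, forall p, g p = Phi p (patch (fun=> point) (below lt p) g).
Proof.
move=> wf.
pose ext p (rec : forall q, lt q p -> U) q :=
  if pselect (lt q p) is left h then rec q h else point.
exists (Fix wf (fun=> U) (fun p rec => Phi p (ext p rec))) => p.
rewrite Fix_eq; last first.
  move=> x f g fg; congr (Phi x _); apply/funext => q.
  by rewrite /ext; case: pselect => // h; exact: fg.
congr (Phi p _); apply/funext => q; rewrite /ext /patch.
case: pselect => h; first by rewrite mem_set.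
by rewrite memNset.
Qed.

(** Transfinite choice of values in [A] outside of a forbidden set [F p g], which
    depends only on the values of [g] below [p]. *)
Lemma wf_avoid (T : Type) (U : pointedType) (lt : T -> T -> Prop) (A : set U)
    (D : set T) (F : T -> (T -> U) -> set U) :
  well_founded lt ->
  (forall p g g', (forall q, lt q p -> g q = g' q) -> F p g = F p g') ->
  (forall p g, D p -> ~ (A `<=` F p g)) ->
  exists g : T -> U, forall p, D p -> A (g p) /\ ~ F p g (g p).
Proof.
move=> wf Fext nF.
have [Phi PhiP] : exists Phi : T -> (T -> U) -> U, forall p g, D p ->
    A (Phi p g) /\ ~ F p g (Phi p g).
  suff /choice[f Pf] : forall pg : T * (T -> U), exists u, D pg.1 ->
      A u /\ ~ F pg.1 pg.2 u.
    by exists (fun p g => f (p, g)) => p g /(Pf (p, g)).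
  move=> [p g] /=; have [Dp|] := pselect (D p); last by exists point.
  have /existsNP[u /not_implyP[Au nFu]] := nF p g Dp.
  by exists u.
have [g gE] := wf_recursion Phi wf.
exists g => p Dp; rewrite gE.
have [? nFp] := PhiP p (patch (fun=> point) (below lt p) g) Dp; split=> //.
rewrite (Fext _ _ (patch (fun=> point) (below lt p) g)) //.
by move=> q qp; rewrite /patch mem_set.
Qed.

(** * The square of an infinite initial segment *)

Lemma card_leX (T U T' U' : pointedType) (A : set T) (A' : set T')
    (B : set U) (B' : set U') :
  A #<= A' -> B #<= B' -> A `*` B #<= A' `*` B'.
Proof.
move=> /pcard_surjP[f fs] /pcard_surjP[g gs].
apply/(@pcard_surjP (T * U)%type); exists (fun p => (f p.1, g p.2)).
move=> [a b] [/= /fs[a' A'a' <-] /gs[b' B'b' <-]].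
by exists (a', b').
Qed.

Lemma infinite_setU1 (T : pointedType) (A : set T) (x : T) :
  infinite_set A -> A `|` [set x] #<= A.
Proof.
move=> /infiniteP /pcard_leP[e].
have einj m n : e m = e n -> m = n by apply: inj; rewrite inE.
have eA n : A (e n) by exact: funS.
(* Shift the sequence [e] by one step to make room for [x]. *)
have [g gP] : exists g : T -> T, g (e 0) = x /\
    (forall n, g (e n.+1) = e n) /\ (forall a, (forall n, a <> e n) -> g a = a).
  suff /choice[g gP] : forall a, exists b, (a = e 0 -> b = x) /\
      (forall n, a = e n.+1 -> b = e n) /\ ((forall n, a <> e n) -> b = a).
    by exists g; split=> [|]; [|split]; move=> *; apply gP.
  move=> a; have [[[|n] ->]|na] := pselect (exists n, a = e n).
  - exists x; split=> [//|]; split=> [n /einj//|nx].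
    by case: (nx 0).
  - exists (e n); split=> [/einj//|]; split=> [m /einj[->]//|nx].
    by case: (nx n.+1).
  - exists a; split=> [a0|]; first by case: na; exists 0.
    by split=> // n an; case: na; exists n.+1.
apply/pcard_surjP; exists g => y [Ay|->]; last by exists (e 0); rewrite ?gP.1.
have [[n ->]|ny] := pselect (exists n, y = e n).
  by exists (e n.+1) => //; rewrite gP.2.1.
by exists y => //; apply: gP.2.2 => n yn; apply: ny; exists n.
Qed.

(** Comparing first by [m] and then arbitrarily yields a well-ordering. *)
Lemma layered_well_ordering (T W : Type) (lt : T -> T -> Prop)
    (w : W -> W -> Prop) (m : W -> T) :
  well_ordering lt -> well_ordering w ->
  well_ordering (fun p q => lt (m p) (m q) \/ m p = m q /\ w p q).
Proof.
move=> [ltwf lttri] [wwf wtri]; split=> [p|p q].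
  move: {2}(m p) (erefl (m p)) => t; elim/(well_founded_ind ltwf): t p => t IHt p.
  elim/(well_founded_ind wwf): p => p IHp mp.
  constructor => q [qp|[qp wqp]]; first by apply: (IHt (m q)); rewrite -?mp.
  by apply: IHp => //; rewrite qp.
have [|[|]] := lttri (m p) (m q); [by left; left| |by right; right; left].
have [|[|]] := wtri p q; [by left; right| by right; left|].
by right; right; right.
Qed.

(** Hessenberg: the square of an infinite initial segment of a well-ordering
    injects into the segment.  The pairs are ordered by their maximum; when
    [below lt t] does not inject into a smaller initial segment, a pair has too
    few predecessors, by induction, for them to exhaust [below lt t], so that
    distinct values can be chosen recursively for all pairs. *)
Lemma card_square_below (T : pointedType) (lt : T -> T -> Prop) t :
  well_ordering lt -> infinite_set (below lt t) ->
  below lt t `*` below lt t #<= below lt t.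
Proof.
move=> wo; have [wf tri] := wo; have ltT := wo_trans wo.
elim/(well_founded_ind wf): t => t IH Iinf.
have subI s : lt s t -> below lt s `<=` below lt t by move=> st r /ltT; exact.
have [[s [st ts]]|nocard] :=
    pselect (exists s, lt s t /\ below lt t #<= below lt s).
  have sinf : infinite_set (below lt s) by move=> /(card_le_finite ts).
  apply: card_le_trans (subset_card_le (subI _ st)).
  exact: card_le_trans (card_leX ts ts) (IH _ st sinf).
have [w wwo] := well_ordering_exists (T * T)%type.
pose m (p : T * T) := if `[< lt p.1 p.2 >] then p.2 else p.1.
have mP a b s : lt (m (a, b)) s \/ m (a, b) = s ->
    (lt a s \/ a = s) /\ (lt b s \/ b = s).
  rewrite /m /=; case: asboolP => [ab|nab] [ms|ms]; try subst s.
  - by split; left => //; exact: ltT ms.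
  - by split; [left|right].
  - by split; left => //; have [|[<-|/ltT]] := tri a b; [|by []|exact].
  - by split; [right|have [|[|]] := tri a b; [by []|right|left]].
have m_below a b : below lt t a -> below lt t b -> below lt t (m (a, b)).
  by move=> ? ?; rewrite /m /=; case: asboolP.
have lt2wo := layered_well_ordering m wo wwo.
set lt2 := (X in well_ordering X) in lt2wo.
have [lt2wf lt2tri] := lt2wo.
have small_seg p : (below lt t `*` below lt t) p ->
    ~ (below lt t #<= below lt2 p).
  case: p => a b [/= ta tb] tle.
  have segs s : lt s t -> below lt t #<= below lt s `*` below lt s -> False.
    move=> st tss; have sinf : infinite_set (below lt s).
      by move=> sfin; apply: Iinf; apply: card_le_finite tss _; exact: finite_setX.
    by apply: nocard; exists s; split=> //; exact: card_le_trans tss (IH _ st sinf).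
  have st := m_below _ _ ta tb; set s := m (a, b) in st.
  have [[s' [ss' s't]]|nos'] := pselect (exists s', lt s s' /\ lt s' t).
    apply: segs s't _; apply: card_le_trans tle _; apply: subset_card_le.
    move=> [c d] pq; have [] := mP c d s; first by case: pq => [|[]]; [left|right].
    by move=> cs ds; split=> /=; [move: cs|move: ds] => -[/ltT|->];
      [exact|by []|exact|by []].
  (* Otherwise [s] is the last element of [below lt t]. *)
  have ts : below lt t `<=` below lt s `|` [set s].
    move=> r rt; have [|[|sr]] := tri r s; [by left|by right|].
    by case: nos'; exists r.
  have sinf : infinite_set (below lt s).
    by move=> sfin; apply: Iinf; apply: sub_finite_set ts _; rewrite finite_setU.
  apply: nocard; exists s; split=> //.
  exact: card_le_trans (subset_card_le ts) (infinite_setU1 _ sinf).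
have [] := @wf_avoid _ T lt2 (below lt t) (below lt t `*` below lt t)
    (fun p g => g @` below lt2 p) lt2wf.
- move=> p g g' gg'; apply/seteqP; split=> _ [q qp <-]; exists q => //.
    by rewrite gg'.
  by rewrite gg'.
- move=> p g Dp /subset_card_le tg; apply: (small_seg p) => //.
  exact: card_le_trans tg (card_image_le _ _).
move=> g gP; apply/pcard_leP; apply/injfunPex; exists g => [p /gP[]//|p q].
rewrite !inE => /gP[_ gp] /gP[_ gq] gpq.
have [pq|[//|qp]] := lt2tri p q; first by case: gq; exists p.
by case: gp; exists q.
Qed.

(** * Sets of size less than the continuum *)

(** The points of the Cantor set. *)
Local Notation C := (nat -> bool).

(** A set is small when its cardinality is less than that of the continuum. *)
Definition small (U : Type) (A : set U) := ~ ([set: C] #<= A).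

Lemma small_le (U V : Type) (A : set U) (B : set V) :
  A #<= B -> small B -> small A.
Proof. by move=> AB sB cA; apply: sB; exact: card_le_trans AB. Qed.

Lemma small_set_type (U : Type) (A : set U) :
  small [set: set_type A] -> small A.
Proof.
by apply: small_le; have := card_setT A; rewrite card_eq_le => /andP[].
Qed.

Lemma infinite_C : infinite_set [set: C].
Proof.
apply/infiniteP/pcard_leTP; apply/injPex; exists (fun n m => m == n) => n m _ _.
by move=> /(congr1 (@^~ n)); rewrite eqxx => /esym/eqP.
Qed.

Lemma small_finite (U : Type) (A : set U) : finite_set A -> small A.
Proof. by move=> fA /card_le_finite/(_ fA); exact: infinite_C. Qed.

(** König: the continuum has uncountable cofinality. *)
Lemma small_bigcup (U : Type) (I : countType) (A : I -> set U) :
  (forall i, small (A i)) -> small (\bigcup_i A i).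
Proof.
move=> sA /pcard_surjP[g gs].
(* A point of [C] encodes a family of points indexed by [I], as [pickle]
   embeds [I * nat] in [nat].  The [i]-th component of [g], restricted to
   [A i], misses some [c i], and then [g] misses the code [d] of this family. *)
have /choice[c cP] : forall i, exists c : C, forall a, A i a ->
    (fun m => g a (pickle (i, m))) <> c.
  move=> i; apply: contrapT => nc; apply: (sA i); apply/pcard_surjP.
  exists (fun a m => g a (pickle (i, m))) => c _; apply: contrapT => nac.
  by apply: nc; exists c => a Aa ac; apply: nac; exists a.
pose d k := if (unpickle k : option (I * nat)) is Some (i, m) then c i m else false.
have [a [i _ Aia] gad] := gs d Logic.I.
by apply: (cP i a Aia); apply/funext => m; rewrite gad /d pickleK.
Qed.

Lemma small_setU (U : Type) (A B : set U) :
  small A -> small B -> small (A `|` B).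
Proof.
move=> sA sB; have : small (\bigcup_(b : bool) (if b then A else B)).
  by apply: small_bigcup => -[].
apply: small_le; apply: subset_card_le => x [Ax|Bx]; first by exists true.
by exists false.
Qed.

(** A well-ordering of the points of the Cantor set, and a set [D] of continuum
    many of them whose elements have small initial segments. *)
Lemma minimal_well_ordering : exists (lt : C -> C -> Prop) (D : set C),
  [/\ well_ordering lt, ~ small D & forall t, D t -> small (below lt t)].
Proof.
have [lt wo] := well_ordering_exists C.
have [[t tns]|allsmall] := pselect (exists t, ~ small (below lt t)); last first.
  exists lt, setT; split=> // [|t _]; first by move=> sC; apply: sC.
  by apply: contrapT => nst; apply: allsmall; exists t.
have [t' nst' mint'] :=
  wf_min (P := fun t => ~ small (below lt t)) wo.1 (ex_intro _ t tns).
exists lt, (below lt t'); split=> // s st'; apply: contrapT; exact: mint'.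
Qed.

Lemma small_square_below (lt : C -> C -> Prop) t :
  well_ordering lt -> small (below lt t) ->
  small (below lt t `*` below lt t).
Proof.
move=> wo st; have [fint|inft] := pselect (finite_set (below lt t)).
  by apply: small_finite; exact: finite_setX.
exact: small_le (card_square_below wo inft) st.
Qed.

(** Given continuum many functions [F c], there is a set of the size of the
    continuum such that only a small number of its points are moved within it by
    [F c] and moved back by [F c'].  The points are chosen recursively, each
    outside of the images of the earlier points by the functions with earlier
    indices. *)
Lemma rigid_set (F : C -> C -> C) : exists S : set C, ~ small S /\
  forall c c', small [set p | S p /\
    exists q, [/\ S q, q <> p, F c p = q & F c' q = p]].
Proof.
have [lt [D [wo nsD sD]]] := minimal_well_ordering.
have [wf tri] := wo.
have [e es] : exists e : C -> C, set_surj D [set: C] e.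
  by apply/pcard_surjP; exact: contrapT nsD.
pose forb t (g : C -> C) := [set F (e u.1) (g u.2) | u in below lt t `*` below lt t]
  `|` g @` below lt t.
have [||x xP] := @wf_avoid _ _ lt setT D forb wf.
- move=> t g g' gg'; congr setU; apply: eq_imagel.
    by move=> [u v] [_ /= vt]; rewrite gg'.
  exact: gg'.
- move=> t g Dt /subset_card_le; rewrite -/(~ _); apply: small_setU.
    exact: small_le (card_image_le _ _) (small_square_below wo (sD t Dt)).
  exact: small_le (card_image_le _ _) (sD t Dt).
have xavoid u v t : D t -> lt u t -> lt v t -> F (e u) (x v) <> x t.
  by move=> /xP[_ nf] ut vt ft; apply: nf; left; exists (u, v).
exists (x @` D); split=> [|c c'].
  move=> sxD; apply: nsD; apply: small_le sxD.
  apply/pcard_leP/injfunPex; exists x => [t Dt|s t]; first by exists t.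
  rewrite !inE => Ds Dt st; have [l|[//|l]] := tri s t.
    by case: (xP t Dt) => _ []; right; exists s.
  by case: (xP s Ds) => _ []; right; exists t.
have [b Db bc] := es c Logic.I; have [b' Db' bc'] := es c' Logic.I.
have : small ((below lt b `|` below lt b') `|` [set b']).
  apply: small_setU; first by apply: small_setU; exact: sD.
  by apply: small_finite; exact: finite_set1.
apply: small_le; apply: card_le_trans (card_image_le x _).
apply: subset_card_le => _ [[t Dt <-]] [_ [[s Ds <-] nst Fcst Fcts]].
exists t => //=; have [l|[st|l]] := tri s t; last 1 first.
- (* [x s] is chosen after [x t], hence not after the index [b] of [c] *)
  left; left; have [bs|[sb|sb]] := tri b s.
  + by case: (xavoid b t s) => //; rewrite bc.
  + by move: l; rewrite -sb.
  + exact: wo_trans wo _ _ _ l sb.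
- (* [x t] is chosen after [x s], hence not after the index [b'] of [c'] *)
  have [b't|[b't|tb']] := tri b' t; [|by right|by left; right].
  by case: (xavoid b' s t) => //; rewrite bc'.
- by case: nst; rewrite st.
Qed.

(** * Subspaces of the Cantor set *)

(** [agree n p q]: the sequences [p] and [q] have the same first [n] terms. *)
Definition agree n (p q : C) := forall k, (k < n)%N -> p k = q k.

Lemma agree_leq n p q k : p k != q k -> agree n p q -> (n <= k)%N.
Proof. by move=> pq a; rewrite leqNgt; apply: contraNN pq => /a ->. Qed.

Section cantor_distance.
Local Open Scope ring_scope.
Import Order.TTheory GRing.Theory Num.Theory.
Variable R : realType.

(** The distance [2 ^- k], where [k] is the first index at which the two
    sequences differ, or [0] if they are equal. *)
Definition cantor_dist (p q : C) : R :=
  if pselect (exists k, p k != q k) is left h then 2 ^- ex_minn h else 0.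

Lemma cantor_distP p q : p = q /\ cantor_dist p q = 0 \/
  exists2 k, p k != q k & cantor_dist p q = 2 ^- k /\ agree k p q.
Proof.
rewrite /cantor_dist; case: pselect => [h|h].
  right; case: ex_minnP => k pk mink; exists k => //; split=> // i ik.
  by apply/eqP/negPn/negP => /mink; rewrite leqNgt ik.
left; split=> //; apply/funext => k; apply/eqP/negPn/negP => pk.
by apply: h; exists k.
Qed.

Lemma le_cantor_dist p q k : p k != q k -> 2 ^- k <= cantor_dist p q.
Proof.
have [[-> _]|[j _ [-> a]] pk] := cantor_distP p q; first by rewrite eqxx.
by rewrite lef_pV2 ?posrE ?exprn_gt0// ler_eXn2l// ?ltr1n// (agree_leq pk).
Qed.

Lemma cantor_dist_ge0 p q : 0 <= cantor_dist p q.
Proof.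
by have [[_ ->]|[k _ [-> _]]] := cantor_distP p q; rewrite ?invr_ge0 ?exprn_ge0.
Qed.

Lemma cantor_dist_lt n p q : cantor_dist p q < 2 ^- n -> agree n p q.
Proof.
move=> pqn k kn; apply/eqP/negPn/negP => /le_cantor_dist.
move=> /le_lt_trans/(_ pqn); rewrite ltf_pV2 ?posrE ?exprn_gt0//.
by rewrite ltr_eXn2l ?ltr1n// ltnNge ltnW.
Qed.

Lemma cantor_dist_le n p q : agree n p q -> cantor_dist p q <= 2 ^- n.
Proof.
have [[_ ->]|[k pk [-> _] a]] := cantor_distP p q.
  by rewrite invr_ge0 exprn_ge0.
by rewrite lef_pV2 ?posrE ?exprn_gt0// ler_eXn2l ?ltr1n// (agree_leq pk).
Qed.

Lemma cantor_distxx p : cantor_dist p p = 0.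
Proof. by have [[_ ->]//|[k]] := cantor_distP p p; rewrite eqxx. Qed.

Lemma cantor_dist_eq0 p q : cantor_dist p q = 0 -> p = q.
Proof.
have [[->]//|[k _ [-> _]] /eqP] := cantor_distP p q.
by rewrite invr_eq0 expf_eq0 pnatr_eq0 andbF.
Qed.

Lemma cantor_dist_sym p q : cantor_dist p q = cantor_dist q p.
Proof.
suff le x y : cantor_dist x y <= cantor_dist y x by apply/eqP; rewrite eq_le !le.
have [[_ ->]|[k xk [-> _]]] := cantor_distP x y; first exact: cantor_dist_ge0.
by apply: le_cantor_dist; rewrite eq_sym.
Qed.

Lemma cantor_dist_triangle q p r :
  cantor_dist p r <= cantor_dist p q + cantor_dist q r.
Proof.
have [[_ ->]|[k pk [-> _]]] := cantor_distP p r.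
  by rewrite addr_ge0 ?cantor_dist_ge0.
have [pq|] := eqVneq (p k) (q k).
  by rewrite ler_wpDl ?cantor_dist_ge0// le_cantor_dist// -pq.
by move=> /le_cantor_dist pq; rewrite ler_wpDr ?cantor_dist_ge0.
Qed.

End cantor_distance.

(** A subset of the Cantor set as a metric space. *)
Definition cantor_sub (R : realType) (S : set C) : Type := set_type S.

HB.instance Definition _ (R : realType) (S : set C) :=
  Choice.copy (cantor_sub R S) (set_type S).

HB.instance Definition _ (R : realType) (S : set C) :=
  @isMetric.Build R (cantor_sub R S)
    (fun x y => cantor_dist R (\val x) (\val y))
    (fun x => cantor_distxx R (\val x))
    (fun x y xy => val_inj (cantor_dist_eq0 xy))
    (fun x y => cantor_dist_sym R (\val x) (\val y))
    (fun y x z => cantor_dist_triangle R (\val y) (\val x) (\val z)).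

(** The basic clopen set of the points of the Cantor set that extend [s]. *)
Definition cyl (s : seq bool) : set C :=
  [set p | forall k, (k < size s)%N -> p k = nth false s k].

Lemma cyl_mkseq n (p q : C) : cyl (mkseq p n) q <-> agree n p q.
Proof.
split=> [pq k kn|pq k]; first by rewrite pq ?size_mkseq// nth_mkseq.
by rewrite size_mkseq => kn; rewrite nth_mkseq// pq.
Qed.

Lemma cyl_agree s (p q : C) : agree (size s) p q -> cyl s p -> cyl s q.
Proof. by move=> pq sp k ks; rewrite -pq// sp. Qed.

Section cantor_sub_topology.
Variables (R : realType) (S : set C).
Local Notation X := (cantor_sub R S).

Lemma nbhs_cantor_sub (x : X) (U : set X) :
  nbhs x U <-> exists n, [set y | agree n (\val x) (\val y)] `<=` U.
Proof.
split=> [/nbhs_ballP[e /= e0 xU]|[n xU]].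
  have [n _ /(_ n (leqnn n)) /=] := near_infty_natSinv_expn_lt (PosNum e0).
  rewrite GRing.mul1r => ne.
  exists n => y xy; apply: xU; rewrite metric_structure.ballEmdist /=.
  exact: Order.POrderTheory.le_lt_trans (cantor_dist_le R xy) ne.
apply/nbhs_ballP; exists (2 ^- n)%R => /=.
  by rewrite Num.Theory.invr_gt0 Num.Theory.exprn_gt0.
move=> y; rewrite metric_structure.ballEmdist => xy; apply: xU.
exact: cantor_dist_lt xy.
Qed.

Lemma cyl_clopen s : clopen [set x : X | cyl s (\val x)].
Proof.
have op b : open [set x : X | cyl s (\val x) <-> b].
  rewrite openE => x xb; apply/nbhs_cantor_sub; exists (size s) => y /= xy.
  apply: iff_trans xb; split; last exact: cyl_agree.
  by apply: cyl_agree => k ks; exact/esym/xy.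
split; first by have := op True; congr open; apply/seteqP; split=> x /=; tauto.
rewrite -[X in closed X]setCK; apply: open_closedC.
by have := op False; congr open; apply/seteqP; split=> x /=; tauto.
Qed.

Lemma cantor_sub_separable : S !=set0 -> separable X.
Proof.
move=> [p Sp]; pose x0 : X := exist _ p (mem_set Sp).
exists (range (fun s : seq bool => xget x0 [set x : X | cyl s (\val x)])).
  exact: card_le_trans (card_image_le _ _) (countableP _).
move=> O [x Ox] oO.
have /nbhs_cantor_sub[n xO] : nbhs x O by apply: open_nbhs_nbhs.
exists (xget x0 [set y : X | cyl (mkseq (\val x) n) (\val y)]); split; last first.
  by exists (mkseq (\val x) n).
apply: xO; case: xgetP => [y _ /cyl_mkseq//|/(_ x)[]].
exact/cyl_mkseq.
Qed.

Lemma cantor_sub_zero_dimensional : S !=set0 -> zero_dimensional_space X.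
Proof.
move=> [p Sp]; split; first by exists (exist _ p (mem_set Sp) : X).
exists (range (fun s : seq bool => [set x : X | cyl s (\val x)])); last first.
  by move=> _ [s _ <-]; exact: cyl_clopen.
split=> [_ [s _ <-]|x U /nbhs_cantor_sub[n xU]]; first by case: (cyl_clopen s).
exists [set y : X | cyl (mkseq (\val x) n) (\val y)].
  by split; [exists (mkseq (\val x) n)|exact/cyl_mkseq].
by move=> y /cyl_mkseq; exact: xU.
Qed.

(** The point of the Cantor set underlying a point of a subspace of [X]. *)
Definition pt (A : set X) (a : set_type A) : C := \val (\val a : X).

Lemma pt_inj (A : set X) : injective (@pt A).
Proof. by move=> a b /val_inj /val_inj. Qed.

Lemma nbhs_pt (A : set X) (a : set_type A) (U : set (set_type A)) :
  nbhs a U <-> exists n, [set b | agree n (pt a) (pt b)] `<=` U.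
Proof.
split=> [[_ [[W oW <-] Wa WU]]|[n aU]].
  have /nbhs_cantor_sub[n aW] : nbhs (\val a : X) W by apply: open_nbhs_nbhs.
  by exists n => b ab; apply: WU; exact: aW.
apply: (filterS aU).
apply: (@initial_continuous (set_type A) X set_val a [set y | agree n (pt a) (\val y)]).
by apply/nbhs_cantor_sub; exists n.
Qed.

End cantor_sub_topology.

(** * Codes for continuous functions *)

(** The partial function from the Cantor set to itself coded by [c], as a
    relation.  The code is the characteristic function of a set of pairs [(s, t)]
    of cylinders, and [q] is the value at [p] when [q] lies in exactly those [t]
    that are paired with some [s] containing [p]. *)
Definition coded (c p q : C) := forall t,
  cyl t q <-> exists2 s, c (pickle (s, t)) & cyl s p.

Lemma coded_fun c p q r : coded c p q -> coded c p r -> q = r.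
Proof.
move=> pq pr; apply/funext => k.
have /pq/pr : cyl (mkseq q k.+1) q by apply/cyl_mkseq.
by move=> /cyl_mkseq; exact.
Qed.

(** Total functions extending the coded partial functions. *)
Lemma decoding_exists : exists F : C -> C -> C, forall c p q,
  coded c p q -> F c p = q.
Proof.
exists (fun c p => xget point [set q | coded c p q]) => c p q pq.
by case: xgetP => [r _ /coded_fun/(_ pq)|/(_ q)].
Qed.

(** Every continuous map between subspaces of the Cantor set has a code. *)
Lemma continuous_coded (R : realType) (S : set C) (A : set (cantor_sub R S))
    (h : set_type A -> set_type A) :
  continuous h -> exists c, forall a, coded c (pt a) (pt (h a)).
Proof.
move=> hc.
pose P (u : seq bool * seq bool) :=
  forall a : set_type A, cyl u.1 (pt a) -> cyl u.2 (pt (h a)).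
exists (fun k => if unpickle k is Some u then `[< P u >] else false) => a t.
split=> [ht|[s]]; last first.
  by rewrite pickleK => /asboolP Pst; exact: Pst.
have /nbhs_pt[n an] : nbhs a (h @^-1` [set b | cyl t (pt b)]).
  apply: hc; apply/nbhs_pt; exists (size t) => b ab; exact: cyl_agree ab ht.
exists (mkseq (pt a) n); last exact/cyl_mkseq.
by rewrite pickleK; apply/asboolP => b /cyl_mkseq /an.
Qed.

(** * Homogeneous subspaces *)

(** A homogeneous subspace of size the continuum has a self-homeomorphism that
    moves continuum many points: move a point all of whose neighborhoods are of
    that size. *)
Lemma homogeneous_moves (R : realType) (S : set C) (A : set (cantor_sub R S)) :
  homogeneous (set_type A) -> ~ small [set: set_type A] ->
  exists2 h : set_type A -> set_type A, homeomorphism h &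
    ~ small [set a | h a <> a].
Proof.
move=> hom nsA.
have [a alarge] : exists a : set_type A,
    forall s, cyl s (pt a) -> ~ small [set b : set_type A | cyl s (pt b)].
  apply: contrapT => noa; apply: nsA.
  (* The small sets among the members of a countable base. *)
pose B (s : seq bool) := [set b : set_type A | cyl s (pt b)
    /\ small [set b : set_type A | cyl s (pt b)]].
  have : small (\bigcup_s B s).
    apply: small_bigcup => s.
    have [sms|nsms] := pselect (small [set b : set_type A | cyl s (pt b)]).
      by apply: small_le sms; apply: subset_card_le => b [].
    by apply: small_finite; rewrite (_ : B s = set0)// -subset0 => b [].
  apply: small_le; apply: subset_card_le => a _.
  have /existsNP[s /not_implyP[sa /contrapT sms]] :
      ~ forall s, cyl s (pt a) -> ~ small [set b : set_type A | cyl s (pt b)].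
    by move=> al; apply: noa; exists a.
  by exists s.
have [b ba] : exists b, b <> a.
  apply: contrapT => nob; apply: nsA; apply: small_finite.
  rewrite (_ : setT = [set a]); first exact: finite_set1.
  apply/seteqP; split=> // b _; apply: contrapT => ba.
  by apply: nob; exists b.
have [h hh hab] := hom a b; exists h => //.
have [k kab] : exists k, pt b k <> pt a k.
  by apply: contrapT => nok; apply: ba; apply: pt_inj; apply/funext => k;
    apply: contrapT => kab; apply: nok; exists k.
have /nbhs_pt[n an] : nbhs a (h @^-1` [set x | agree k.+1 (pt b) (pt x)]).
  by apply: hh.1; apply/nbhs_pt; exists k.+1; rewrite hab.
(* On this cylinder, a point has the [k]-th term of [a], and its image that of
   [b]. *)
pose s := mkseq (pt a) (maxn n k.+1).
have /alarge nss : cyl s (pt a) by exact/cyl_mkseq.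
move=> smoved; apply: nss; apply: small_le smoved.
apply: subset_card_le => x /cyl_mkseq ax hx; apply: kab.
rewrite (ax k) ?leq_max ?ltnSn ?orbT// -hx.
by apply: (an x) => // i il; apply: ax; rewrite leq_max il.
Qed.

Theorem theorem1p2 (R : realType) :
  exists X : topologicalType,
    [/\ is_space R X, zero_dimensional_space X & ~ sigma_homogeneous X].
Proof.
have [F FP] := decoding_exists; have [S [nsS rigid]] := rigid_set F.
have S0 : S !=set0.
  apply: contrapT => nS; apply: nsS; apply: small_finite.
  rewrite (_ : S = set0)// -subset0 => p Sp; apply: nS; by exists p.
exists (cantor_sub R S : topologicalType); split.
- split; first exact: cantor_sub_separable.
  have idc : continuous (@idfun (cantor_sub R S)) by move=> x; exact: cvg_id.
  by exists (cantor_sub R S), idfun; split; [|exists idfun].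
- exact: cantor_sub_zero_dimensional.
move=> [A [homA AT]].
have [n nsA] : exists n, ~ small (A n).
  apply: contrapT => noA; apply: nsS.
  have : small (\bigcup_n A n).
    by apply: small_bigcup => n; apply: contrapT => nsA; apply: noA; exists n.
  by rewrite AT; exact: small_set_type.
have nsAT : ~ small [set: set_type (A n)].
  by move/small_set_type.
have [h [hc [g gc [hK gK]]] []] := homogeneous_moves (homA n) nsAT.
have [c cP] := continuous_coded hc; have [c' c'P] := continuous_coded gc.
apply: small_le (rigid c c').
rewrite -(card_le_eql (inj_card_eq (f := @pt R S (A n)) _)); last first.
  by move=> x y _ _; exact: pt_inj.
have Spt (a : set_type (A n)) : S (pt a) by apply: set_mem; exact: (valP (\val a)).
apply: subset_card_le => _ [a /= ha <-]; split=> //.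
exists (pt (h a)); split=> //; [by move/pt_inj|exact: FP|].
by apply: FP; have := c'P (h a); rewrite hK.
Qed.
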